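(* Let $\Phi_1,\Phi_2,\Phi_3$ be three biconvex subsets of $\Phi^+$ such that $\Phi_3=\Phi_1\cup\Phi_2$ and $\Phi_1\cap\Phi_2=\emptyset$. Let $\beta$ and $\gamma$ be two positive roots such that (i) $\beta\in\Phi_1$; (ii) $\gamma\notin\Phi_3$; (iii) $\gamma+\beta\in\Phi_3$. Then $\Phi_2\cap[\beta;\gamma]$ is empty.
   Context: $\Phi$ is the (reduced, crystallographic) root system of a complex semisimple algebraic group, with Weyl group $W$, a fixed choice of positive roots $\Phi^+$, negative roots $\Phi^-=-\Phi^+$, and simple roots $\Delta$. For $w\in W$, $\Phi(w)=\Phi^+\cap w^{-1}\Phi^-$. A subset of $\Phi^+$ is biconvex if it is of the form $\Phi(w)$ for some $w\in W$; equivalently, it and its complement in $\Phi^+$ are both convex, where $\Psi\subset\Phi^+$ is convex if $\varphi,\psi\in\Psi$ and $\varphi+\psi\in\Phi$ imply $\varphi+\psi\in\Psi$. For $\varphi,\psi\in\Phi$, write $\varphi\le\psi$ if $\psi-\varphi\in\sum_{\alpha\in\Delta}\mathbb{N}\alpha$ (with $0\in\mathbb{N}$), and $[\varphi;\psi]=\{\theta\in\Phi:\varphi\le\theta\le\psi\}$. *)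

(* Defs.v *)
From HB Require Import structures.
From mathcomp Require Import all_boot all_order all_algebra.
From mathcomp Require Import classical_sets.

Set Implicit Arguments.
Unset Strict Implicit.
Unset Printing Implicit Defensive.

Import Order.TTheory GRing.Theory Num.Theory.
Local Open Scope ring_scope.
Local Open Scope classical_set_scope.

Section RootSystem.
Variables (R : realFieldType) (V : vectType R) (dot : {dot V for idfun}).

Definition cartan (b a : V) : R := 2 * dot b a / dot a a.

Definition reflection (a v : V) : V := v - cartan v a *: a.

(* A reduced crystallographic root system of the Euclidean space (V, dot); the
   finite set of roots is given by an enumeration, in which repetitions are
   harmless. *)
Record root_system (Phi : seq V) : Prop := RootSystem {
  root_span : <<Phi>>%VS = fullv;
  root_neq0 : 0 \notin Phi;
  root_reflection : forall a b, a \in Phi -> b \in Phi -> reflection a b \in Phi;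
  root_crystallographic : forall a b, a \in Phi -> b \in Phi ->
    exists k : int, cartan b a = k%:~R;
  root_reduced : forall (a : V) (c : R), a \in Phi -> c *: a \in Phi ->
    c = 1 \/ c = -1
}.

(* As reflections are involutive, the group they generate consists of their
   finite composites. *)
Inductive weyl_group (Phi : seq V) : set (V -> V) :=
| weyl_id : weyl_group Phi idfun
| weyl_reflection a w : a \in Phi -> weyl_group Phi w ->
    weyl_group Phi (reflection a \o w).

Definition nat_span (Delta : seq V) : set V :=
  [set v | exists c : V -> nat, v = \sum_(a <- Delta) a *+ c a].

Record simple_roots (Phi Delta : seq V) : Prop := SimpleRoots {
  simple_sub : {subset Delta <= Phi};
  simple_basis : basis_of fullv Delta;
  simple_sign : forall b, b \in Phi ->
    nat_span Delta b \/ nat_span Delta (- b)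
}.

Definition positive_roots (Phi Delta : seq V) : set V :=
  [set b | b \in Phi /\ nat_span Delta b].

Definition negative_roots (Phi Delta : seq V) : set V :=
  [set b | positive_roots Phi Delta (- b)].

Definition inversions (Phi Delta : seq V) (w : V -> V) : set V :=
  positive_roots Phi Delta `&` w @^-1` negative_roots Phi Delta.

Definition biconvex (Phi Delta : seq V) (A : set V) : Prop :=
  exists2 w, weyl_group Phi w & A = inversions Phi Delta w.

Definition root_le (Delta : seq V) (a b : V) : Prop := nat_span Delta (b - a).

Definition root_interval (Phi Delta : seq V) (a b : V) : set V :=
  [set t | [/\ t \in Phi, root_le Delta a t & root_le Delta t b]].

End RootSystem.

(* Main.v *)
(* Label a positive root 1, 2 or 0 according to whether it lies in [Phi1], in
   [Phi2] or in neither. Biconvexity says that the label of a sum of two roots is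
   one of the labels of the summands, so [beta + gamma] has label 1 and more is
   true: no root of the larger interval [beta; beta + gamma] has label 2.
   Suppose [theta] is such a root. A chain of roots from [beta] to [theta] can be
   rearranged so that its first step [x] is not labelled 0. Then [gamma - x] or
   [beta + gamma + x] is a root. In the first case [beta + x] has label 1 and
   (beta + x, gamma - x) is again a counterexample; in the second one
   (beta + x, gamma) is, possibly after exchanging the labels 1 and 2. The process
   stops, because it lowers [gamma] or raises [beta] with [gamma] unchanged. *)

Require Import Defs.
From HB Require Import structures.
From mathcomp Require Import all_boot all_order all_algebra.
From mathcomp Require Import classical_sets.
From mathcomp Require Import boolp lra.

Set Implicit Arguments.
Unset Strict Implicit.
Unset Printing Implicit Defensive.

Import Order.TTheory GRing.Theory Num.Theory.
Local Open Scope ring_scope.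
Local Open Scope classical_set_scope.

Section DotProduct.
Variables (R : realFieldType) (V : vectType R) (dot : {dot V for idfun}).

Lemma dotC u v : dot u v = dot v u.
Proof. by rewrite hermC /= expr0 mul1r. Qed.

Lemma dotDl u v w : dot (u + v) w = dot u w + dot v w.
Proof. exact: linearDl. Qed.

Lemma dotDr u v w : dot w (u + v) = dot w u + dot w v.
Proof. by rewrite dotC dotDl !(dotC w). Qed.

Lemma dotNl u w : dot (- u) w = - dot u w.
Proof. exact: linearNl. Qed.

Lemma dotNr u w : dot w (- u) = - dot w u.
Proof. by rewrite dotC dotNl dotC. Qed.

Lemma dot_gt0 u : u != 0 -> 0 < dot u u.
Proof. exact: neq0_dnorm_gt0. Qed.

Lemma reflectionD a : {morph reflection dot a : u v / u + v}.
Proof.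
move=> u v; rewrite /reflection /cartan dotDl mulrDr mulrDl scalerDl.
by rewrite opprD addrACA.
Qed.

End DotProduct.

(** * Sums and differences of roots *)

Section Roots.
Variables (R : realFieldType) (V : vectType R) (dot : {dot V for idfun}).
Variables (Phi : seq V) (hPhi : root_system dot Phi).

Lemma root_nz a : a \in Phi -> a != 0.
Proof. by apply: contraTneq => ->; exact: root_neq0 hPhi. Qed.

Lemma rootN a : a \in Phi -> - a \in Phi.
Proof.
move=> aP; suff <- : reflection dot a a = - a by exact: (root_reflection hPhi).
have a0 := dot_gt0 dot (root_nz aP).
rewrite /reflection /cartan mulfK ?gt_eqF // scaler_nat mulr2n opprD addrA.
by rewrite subrr add0r.
Qed.

(** A Cartan integer equal to 1 makes a reflection produce [u - v] or [v - u]. If both are at least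
    2, then [u - v] has norm at most 0, so [u = v]; hence the extra [0]. *)
Lemma sub_root u v : u \in Phi -> v \in Phi -> 0 < dot u v ->
  u - v \in 0 :: Phi.
Proof.
move=> uP vP uv.
have u0 := dot_gt0 dot (root_nz uP); have v0 := dot_gt0 dot (root_nz vP).
have cartanP x y : x \in Phi -> y \in Phi -> 0 < dot x y -> 0 < dot y y ->
    x - y \in Phi \/ dot y y <= dot x y.
  move=> xP yP xy y0; have [k ek] := root_crystallographic hPhi yP xP.
  have : 0 < k%:~R :> R by rewrite -ek divr_gt0 ?mulr_gt0.
  rewrite ltr0z => k0; have [k1|k1] := eqVneq k 1.
    left; have := root_reflection hPhi yP xP.
    by rewrite /reflection ek k1 scale1r.
  right; have : (2 <= k)%R by case: k k0 k1 {ek} => [[|[|k]]|k].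
  rewrite -(ler_int R) -ek /cartan ler_pdivlMr //; lra.
have [|vu] := cartanP _ _ uP vP uv v0; first by rewrite inE => ->; rewrite orbT.
have vu0 : 0 < dot v u by rewrite dotC.
have [|uu] := cartanP _ _ vP uP vu0 u0.
  by move=> /rootN; rewrite opprB inE => ->; rewrite orbT.
rewrite inE; apply/orP; left; apply: contraTT isT => /(dot_gt0 dot).
rewrite dotDl !dotDr !dotNl !dotNr; rewrite (dotC _ v u) in uu *; lra.
Qed.

Lemma add_root u v : u \in Phi -> v \in Phi -> dot u v < 0 ->
  u + v \in 0 :: Phi.
Proof.
move=> uP vP uv; rewrite -[v]opprK; apply: sub_root; rewrite ?rootN //.
by rewrite dotNr oppr_gt0.
Qed.

(* Root-theoretic form of the Jacobi identity for [[e_r, e_x], e_y]. *)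
Lemma root_exchange r x y : r \in Phi -> x \in Phi -> y \in Phi ->
  r + x \in Phi -> r + x + y \in Phi ->
  r + y \in 0 :: Phi \/ x + y \in 0 :: Phi.
Proof.
move=> rP xP yP rxP sP.
have [ry|ry] := ltP (dot r y) 0; first by left; exact: add_root.
have [xy|xy] := ltP (dot x y) 0; first by right; exact: add_root.
have [sx|sx] := ltP 0 (dot (r + x + y) x).
  by left; have := sub_root sP xP sx; rewrite addrAC addrK.
have [sr|sr] := ltP 0 (dot (r + x + y) r).
  by right; have := sub_root sP rP sr; rewrite -(addrA r) addrAC subrr add0r.
(* Now [r + x + y] has product at most 0 with [r + x], but this product is the positive norm of
   [r + x] plus two nonnegative terms. *)
have := dot_gt0 dot (root_nz rxP).
move: sx sr; rewrite !dotDl !dotDr (dotC _ y) (dotC _ y); lra.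
Qed.

Lemma weylD w : weyl_group dot Phi w -> {morph w : u v / u + v}.
Proof. by elim=> [|a {}w _ _ IH] u v //=; rewrite IH reflectionD. Qed.

Lemma weyl_root w a : weyl_group dot Phi w -> a \in Phi -> w a \in Phi.
Proof. by elim=> [|b {}w bP _ IH] //= /IH; exact: root_reflection hPhi _ _ bP. Qed.

End Roots.

(** * Positive roots, height and the root order *)

Section Positivity.
Variables (R : realFieldType) (V : vectType R) (dot : {dot V for idfun}).
Variables (Phi Delta : seq V) (hPhi : root_system dot Phi).
Variable (hDelta : simple_roots Phi Delta).

Local Notation pos := (positive_roots Phi Delta).
Local Notation le := (root_le Delta).

Lemma nat_span0 : nat_span Delta 0.
Proof. by exists (fun=> 0%N); rewrite big1. Qed.

Lemma nat_spanD u v :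
  nat_span Delta u -> nat_span Delta v -> nat_span Delta (u + v).
Proof.
move=> [c ->] [d ->]; exists (fun a => c a + d a)%N.
by rewrite -big_split; apply: eq_bigr => a _; rewrite mulrnDr.
Qed.

Lemma simple_uniq : uniq Delta.
Proof. exact/free_uniq/(basis_free (simple_basis hDelta)). Qed.

Lemma nat_span_subl (c : V -> nat) a : a \in Delta -> (0 < c a)%N ->
  nat_span Delta (\sum_(b <- Delta) b *+ c b - a).
Proof.
move=> aD ca; exists (fun b => c b - (b == a))%N.
rewrite !(bigD1_seq a) ?simple_uniq //= eqxx mulrnBr // mulr1n addrAC.
by congr (_ + _); apply: eq_bigr => b /negPf->; rewrite subn0.
Qed.

Lemma nat_span_simple a : a \in Delta -> nat_span Delta a.
Proof.
move=> aD; exists (fun b => (b == a) : nat).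
rewrite (bigD1_seq a) ?simple_uniq //= eqxx mulr1n big1 ?addr0 //.
by move=> b /negPf->.
Qed.

(** Coordinates make the height additive on all of [V], differences included. *)
Definition height (v : V) : R := \sum_i coord (in_tuple Delta) i v.

Lemma heightD : {morph height : u v / u + v}.
Proof. by move=> u v; rewrite -big_split; apply: eq_bigr => i _; rewrite linearD. Qed.

Lemma heightN u : height (- u) = - height u.
Proof. by rewrite -sumrN; apply: eq_bigr => i _; rewrite linearN. Qed.

Lemma height_simple a : a \in Delta -> height a = 1.
Proof.
move=> aD; have fD : free (in_tuple Delta) := basis_free (simple_basis hDelta).
have ia : (index a Delta < size Delta)%N by rewrite index_mem.
rewrite /height -(nth_index 0 aD) (bigD1 (Ordinal ia)) //=.
rewrite (coord_free (Ordinal ia)) // eqxx big1 ?addr0 // => i /negPf ni.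
by rewrite (coord_free (Ordinal ia)) // eq_sym ni.
Qed.

Lemma height_nat_span (c : V -> nat) :
  height (\sum_(a <- Delta) a *+ c a) = (\sum_(a <- Delta) c a)%:R.
Proof.
have h0 : height 0 = 0 by have := heightN 0; rewrite oppr0; lra.
rewrite (big_morph _ heightD h0) natr_sum big_seq [RHS]big_seq.
apply: eq_bigr => a /height_simple ha; elim: (c a) => [|n IH] //.
by rewrite mulrS heightD IH ha -natr1 addrC.
Qed.

Lemma nat_span_height v : nat_span Delta v ->
  exists2 n, height v = n%:R & n = 0%N -> v = 0.
Proof.
move=> [c ->]; eexists; first exact: height_nat_span.
move/eqP; rewrite sum_nat_seq_eq0 => /allP c0.
by rewrite big_seq big1 // => a /c0 /eqP ->.
Qed.

Lemma height_pos v : pos v -> 1 <= height v.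
Proof.
move=> [/(root_nz hPhi) v0 /nat_span_height[[|n] -> n0]]; last by rewrite ler1n.
by rewrite n0 ?eqxx in v0.
Qed.

Lemma height_ge0 v : nat_span Delta v -> 0 <= height v.
Proof. by case/nat_span_height=> n -> _. Qed.

Lemma root_leD u v x : le u v -> nat_span Delta x -> le u (v + x).
Proof. by rewrite /root_le addrAC; exact: nat_spanD. Qed.

Lemma root_le_add u x : nat_span Delta x -> le u (u + x).
Proof. by rewrite /root_le addrAC subrr add0r. Qed.

Lemma root_le_trans v u t : le u v -> le v t -> le u t.
Proof. by move=> /nat_spanD H /H; rewrite addrC addrA subrK. Qed.

Lemma root_le_pos u v : v \in Phi -> pos u -> le u v -> pos v.
Proof. by move=> vP [_ /nat_spanD H] /H; rewrite addrC subrK; split. Qed.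

Lemma pos_add u v : pos u -> pos v -> u + v \in 0 :: Phi -> pos (u + v).
Proof.
move=> pu pv; rewrite inE => /orP[/eqP e|?].
  by have := height_pos pu; have := height_pos pv; have := heightD u v;
     rewrite e; have := heightN 0; rewrite oppr0; lra.
by split=> //; apply: nat_spanD; [case: pu | case: pv].
Qed.

(** * Convexity of inversion sets and of their complements *)

Lemma biconvex_sub A : biconvex dot Phi Delta A -> A `<=` pos.
Proof. by case=> w _ -> v []. Qed.

Lemma biconvex_add A u v : biconvex dot Phi Delta A -> pos (u + v) ->
  A u -> A v -> A (u + v).
Proof.
move=> [w wW ->] puv [[uP _] [wu nu]] [[vP _] [wv nv]]; split=> //=.
rewrite /negative_roots /positive_roots /= (weylD wW) opprD.
split; last exact: nat_spanD.
by rewrite -opprD -(weylD wW) (rootN hPhi) // (weyl_root hPhi wW) //; case: puv.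
Qed.

Lemma biconvex_split A u v : biconvex dot Phi Delta A -> pos u -> pos v ->
  A (u + v) -> A u \/ A v.
Proof.
move=> [w wW ->] pu pv [puv [_ nw]].
have signP x : pos x -> inversions Phi Delta w x \/ nat_span Delta (w x).
  move=> px; have wx := weyl_root hPhi wW px.1.
  have [|nx] := simple_sign hDelta wx; first by right.
  by left; split=> //; split=> //; exact: rootN hPhi _ wx.
have [|wu] := signP u pu; first by left.
have [|wv] := signP v pv; first by right.
(* If [w] keeps both [u] and [v] positive, it keeps [u + v] positive, so [u + v] is not an
   inversion. *)
have /height_pos : pos (w (u + v)).
  split; first exact: (weyl_root hPhi wW puv.1).
  by rewrite (weylD wW); exact: nat_spanD.
by have := height_ge0 nw; rewrite heightN; lra.
Qed.

(** * Chains of roots and their rearrangement *)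

Inductive chain (A : set V) (u : V) : V -> Prop :=
| chain_nil : chain A u u
| chain_step v x : chain A u v -> A x -> v + x \in Phi -> chain A u (v + x).

Lemma chain_cons A u x v : A x -> u + x \in Phi -> chain A (u + x) v -> chain A u v.
Proof.
move=> Ax uxP; elim=> [|t y _ IH Ay tyP]; last exact: chain_step.
by apply: chain_step => //; exact: chain_nil.
Qed.

Lemma pos_simple a : a \in Delta -> pos a.
Proof. by move=> aD; split; [exact: simple_sub hDelta _ aD | exact: nat_span_simple]. Qed.

(* A cover of the root order adds a simple root: some simple [a] in the support
   of [v - u] has positive product with it, hence [v - a] or [u + a] is a root. *)
Lemma chain_le u v : pos u -> pos v -> le u v -> chain pos u v.
Proof.
move=> pu pv luv; have [n hn _] := nat_span_height luv.
elim: n u v pu pv luv hn => [|n IH] u v pu pv luv hn.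
  have [[|m] hm m0] := nat_span_height luv; last first.
    by move/eqP: hn; rewrite hm pnatr_eq0.
  by rewrite -(subrK u v) m0 // add0r; exact: chain_nil.
have [c ec] := luv.
have /(dot_gt0 dot) : v - u != 0.
  apply/eqP => e; move: hn; rewrite e -(subrr u) heightD heightN subrr => /eqP.
  by rewrite eq_sym pnatr_eq0.
rewrite {2}ec => d0.
(* The positive norm of [v - u] is the sum of the [c a * dot (v - u) a], so some term is
   positive. *)
have [a aD [ca da]] : exists2 a, a \in Delta & (0 < c a)%N /\ 0 < dot (v - u) a.
  apply: contrapT => H; move: d0; rewrite ltNge => /negP; apply.
  rewrite (big_morph _ (fun s t => dotDr dot s t (v - u)) (linear0r dot _)).
  rewrite big_seq; apply: sumr_le0 => a aD.
  case: (posnP (c a)) => [->|ca]; first by rewrite mulr0n linear0r.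
  rewrite linearMn; apply: mulrn_wle0; rewrite leNgt; apply/negP => da.
  by apply: H; exists a.
have pa := pos_simple aD.
have hva : height (v - u - a) = n%:R.
  by rewrite heightD hn heightN height_simple // -natr1 addrK.
have lva : nat_span Delta (v - u - a) by rewrite ec; exact: nat_span_subl.
have [ua|ua] := ltP (dot u a) 0.
  have pua := pos_add pu pa (add_root hPhi pu.1 pa.1 ua).
  have e : v - (u + a) = v - u - a by rewrite opprD addrA.
  apply: (@chain_cons _ _ a) => //; first exact: pua.1.
  by apply: IH => //; rewrite /root_le e.
have va : 0 < dot v a by move: da; rewrite dotDl dotNl; lra.
have e : v - a - u = v - u - a by rewrite addrAC.
have lu : le u (v - a) by rewrite /root_le e.
have pva : pos (v - a).
  have := sub_root hPhi pv.1 pa.1 va; rewrite inE => /orP[/eqP va0|vaP].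
    have := height_ge0 lu; rewrite va0 heightD heightN.
    by have := height_pos pu; have := heightD 0 0; rewrite addr0; lra.
  exact: root_le_pos pu lu.
rewrite -[v](subrK a); apply: chain_step; rewrite ?subrK //; last exact: pv.1.
by apply: IH => //; rewrite e.
Qed.

Section Sift.
Variable A : set V.
Hypothesis Apos : A `<=` pos.

(** Of a rearranged chain, only the first step and an upper bound are retained. *)
Definition first_step_off u v :=
  exists x, [/\ pos x, ~ A x, u + x \in Phi & le (u + x) v].

Lemma chain_root u v : pos u -> chain A u v -> pos v /\ le u v.
Proof.
move=> pu; elim=> [|t x _ [pt lt] /Apos px txP].
  by split=> //; rewrite /root_le subrr; exact: nat_span0.
have lx : le u (t + x) by apply: root_leD => //; exact: px.2.
by split=> //; apply: root_le_pos lx.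
Qed.

Lemma first_step_off_le u v t : first_step_off u v -> le v t -> first_step_off u t.
Proof. by move=> [x [px Ax ux uxv]] vt; exists x; split=> //; exact: root_le_trans vt. Qed.

(** The new step [y] moves towards [u]: by [root_exchange] it either passes before the last step [x]
    or merges with it into the step [x + y]. *)
Lemma chain_push u v y : pos u -> chain A u v -> pos y -> v + y \in Phi ->
  chain A u (v + y) \/ first_step_off u (v + y).
Proof.
move=> pu uv; elim: uv y => [|t x ut IH Ax txP] y py yP.
  have [Ay|nAy] := pselect (A y).
    by left; apply: chain_step => //; exact: chain_nil.
  by right; exists y; split=> //; rewrite /root_le subrr; exact: nat_span0.
have px := Apos Ax; have [pt _] := chain_root pu ut.
have [ty|xy] := root_exchange hPhi pt.1 px.1 py.1 txP yP.
  have [tyP _] := pos_add pt py ty.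
  have [uty|off] := IH y py tyP.
    by left; rewrite addrAC; apply: chain_step => //; rewrite addrAC.
  right; apply: (first_step_off_le off).
  by rewrite addrAC; apply: root_le_add; exact: px.2.
by rewrite -addrA; apply: IH; rewrite ?addrA //; exact: pos_add.
Qed.

Lemma chain_sift u v : pos u -> chain pos u v -> chain A u v \/ first_step_off u v.
Proof.
move=> pu; elim=> [|t x _ [ut|off] px txP]; first by left; exact: chain_nil.
  exact: chain_push.
by right; apply: (first_step_off_le off); apply: root_le_add; exact: px.2.
Qed.

End Sift.

Lemma height_bound : exists M : nat, forall v, pos v -> height v <= M%:R.
Proof.
suff [M hM] : exists M : nat, forall v, v \in Phi -> nat_span Delta v -> height v <= M%:R.
  by exists M => v [vP /hM]; exact.
elim: Phi => [|a s [M IH]]; first by exists 0%N.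
have [/nat_span_height[k ek _]|na] := pselect (nat_span Delta a); last first.
  by exists M => v; rewrite inE => /orP[/eqP->|/IH].
exists (M + k)%N => v; rewrite natrD inE => /orP[/eqP->|vs vn].
  by rewrite ek lerDr ler0n.
by apply: le_trans (IH _ vs vn) _; rewrite lerDl ler0n.
Qed.

(** By [biconvex_split], membership in [P2] passes back along steps outside [P2], down to [b], which
    lies in [P1]. *)
Lemma chain_avoids (P1 P2 : set V) b t :
  biconvex dot Phi Delta P2 -> P1 `&` P2 = set0 -> pos b -> P1 b ->
  chain (pos `\` (P1 `|` P2)) b t -> ~ P2 t.
Proof.
move=> c2 d12 pb b1; elim=> [|v x bv nv2 [px nx] _] t2.
  by suff : (P1 `&` P2) b by rewrite d12.
have Apos : pos `\` (P1 `|` P2) `<=` pos by move=> ? [].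
have [pv _] := chain_root Apos pb bv.
by have [|x2] := biconvex_split c2 pv px t2; [|apply: nx; right].
Qed.

(* When [b + g + x] is a root, the configuration is translated by [x]; if [x]
   carries it into [P2], the roles of [P1] and [P2] are exchanged and [b + g]
   becomes the intermediate root. This increases the height of [b] while [g] is
   unchanged. Otherwise [g - x] is a root and replaces [g]. *)
Lemma interval_avoids (P1 P2 : set V) b g t :
  biconvex dot Phi Delta P1 -> biconvex dot Phi Delta P2 ->
  biconvex dot Phi Delta (P1 `|` P2) -> P1 `&` P2 = set0 ->
  P1 b -> pos g -> ~ (P1 `|` P2) g -> P1 (b + g) ->
  le b t -> le t (b + g) -> ~ P2 t.
Proof.
have [M hM] := height_bound.
move=> c1 c2 c3 d12 b1 pg ng d1 lbt ltd t2.
(* Lexicographic induction: [n] bounds the height of [g], and [m] bounds how far the height of [b]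
   is below [M]. *)
have [n hn _] := nat_span_height pg.2.
have {hn} hg : height g <= n%:R by rewrite hn.
have [m hb] : exists m, M%:R <= height b + m%:R.
  by exists M; have := height_pos (biconvex_sub c1 b1); lra.
elim: n m P1 P2 b g t c1 c2 c3 d12 b1 pg ng d1 t2 lbt ltd hg hb => [|n IHn].
  by move=> ? ? ? ? g ? _ _ _ _ _ /height_pos; lra.
elim=> [|m IHm] P1 P2 b g t c1 c2 c3 d12 b1 pg ng d1 t2 lbt ltd hg hb.
  have := hM _ (biconvex_sub c1 d1); have := height_pos pg.
  by rewrite heightD; lra.
have disj v : P1 v -> P2 v -> False.
  by move=> v1 v2; suff : (P1 `&` P2) v by rewrite d12.
have pb := biconvex_sub c1 b1; have pd := biconvex_sub c1 d1.
have pt := biconvex_sub c2 t2.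
have Apos : pos `\` (P1 `|` P2) `<=` pos by move=> ? [].
have [bt|] := chain_sift Apos pb (chain_le pb pt lbt).
  exact: chain_avoids bt t2.
move=> [x [px nAx bxP lxt]].
have x3 : (P1 `|` P2) x by apply: contrapT => nx; apply: nAx.
have lbx : le b (b + x) by apply: root_le_add; exact: px.2.
have pbx := root_le_pos bxP pb lbx.
have lxd := root_le_trans lxt ltd.
have gx : nat_span Delta (g - x).
  by move: lxd; rewrite /root_le opprD addrACA subrr add0r.
have hx := height_pos px.
(* The exchange is applied to [b + x] written as [(b + g) + (- g) + x], with [b] as partial sum. *)
have exch : b + g + x \in 0 :: Phi \/ - g + x \in 0 :: Phi.
  by apply: (root_exchange hPhi pd.1 (rootN hPhi pg.1) px.1); rewrite addrK //;
     exact: pb.1.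
case: exch => [/(pos_add pd px) pdx|]; last first.
  rewrite inE addrC -opprB => /orP[|/(rootN hPhi)].
    by rewrite oppr_eq0 subr_eq0 => /eqP e; apply: ng; rewrite e.
  rewrite opprK => gxP; have pgx : pos (g - x) by [].
  have ngx : ~ (P1 `|` P2) (g - x).
    move=> gx3; apply: ng; rewrite -(subrK x g).
    by apply: (biconvex_add c3) => //; rewrite subrK.
  have e : b + x + (g - x) = b + g by rewrite addrACA subrr addr0.
  have [bx1|gx1] : P1 (b + x) \/ P1 (g - x).
  - by apply: (biconvex_split c1) => //; rewrite e.
  (* The height of [g] drops by at least 1, so the second counter may restart at [M]. *)
  - apply: (IHn M P1 P2 (b + x) (g - x) t) => //; rewrite ?e //.
      by move: hg; rewrite heightD heightN -natr1; lra.
    by have := height_pos pbx; lra.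
  - by apply: ngx; left.
have e : b + g + x = b + x + g by rewrite addrAC.
rewrite e in pdx.
have ldd : le (b + g) (b + x + g).
  by rewrite -e; apply: root_le_add; exact: px.2.
have hbx : M%:R <= height (b + x) + m%:R.
  by move: hb; rewrite heightD -natr1; lra.
have bx3 : (P1 `|` P2) (b + x) by apply: (biconvex_add c3) => //; left.
have dx3 : (P1 `|` P2) (b + x + g).
  by rewrite -e; apply: (biconvex_add c3) => //; [rewrite e|left].
case: bx3 => bx.
  apply: (IHm P1 P2 (b + x) g t) => //; last exact: root_le_trans ldd.
  case: dx3 => // /(biconvex_split c2 pbx pg)[/(disj _ bx)//|g2].
  by case: ng; right.
(* Here [b + x] and [b + x + g] lie in [P2], and [b + g] in [P1] lies between them. *)
apply: (IHm P2 P1 (b + x) g (b + g)) => //; rewrite 1?setUC 1?setIC //.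
case: dx3 => // /(biconvex_split c1 pbx pg)[/disj/(_ bx)//|g1].
by case: ng; left.
Qed.

End Positivity.

Theorem theorem2 (R : realFieldType) (V : vectType R) (dot : {dot V for idfun})
    (Phi Delta : seq V) (hPhi : root_system dot Phi)
    (hDelta : simple_roots Phi Delta)
    (Phi1 Phi2 Phi3 : set V)
    (h1 : biconvex dot Phi Delta Phi1)
    (h2 : biconvex dot Phi Delta Phi2)
    (h3 : biconvex dot Phi Delta Phi3)
    (hU : Phi3 = Phi1 `|` Phi2) (hI : Phi1 `&` Phi2 = set0)
    (beta gamma : V)
    (hbeta : positive_roots Phi Delta beta)
    (hgamma : positive_roots Phi Delta gamma)
    (hi : Phi1 beta) (hii : ~ Phi3 gamma) (hiii : Phi3 (gamma + beta)) :
  Phi2 `&` root_interval Phi Delta beta gamma = set0.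
Proof.
subst Phi3; rewrite -subset0 => t [t2 [_ lbt ltg]].
rewrite addrC in hiii.
(* Membership in [Phi2] would pass to [beta] or [gamma]. *)
have d1 : Phi1 (beta + gamma).
  case: hiii => // /(biconvex_split hPhi hDelta h2 hbeta hgamma)[b2|g2].
    by suff : (Phi1 `&` Phi2) beta by rewrite hI.
  by case: hii; right.
apply: (interval_avoids hPhi hDelta h1 h2 h3 hI hi hgamma hii d1 lbt _ t2).
by rewrite addrC; apply: root_le_trans ltg _; apply: root_le_add; case: hbeta.
Qed.
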